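(* For all integers $1\leq d,\ell\leq k-1$ and $q\geq 2$, we have $\delta_{qd}^{\mathrm{ham}}(qk,q\ell)\leq \delta_{d}^{\mathrm{ham}}(k,\ell)$.
   Context: A $k$-graph $G$ consists of a vertex set $V(G)$ and an edge set of $k$-element subsets of $V(G)$. For $0\le\ell<k$, a ($k$-uniform) $\ell$-cycle is a $k$-graph whose vertices can be cyclically ordered so that every edge consists of $k$ cyclically consecutive vertices and consecutive edges intersect in exactly $\ell$ vertices. An $\ell$-cycle in $G$ is Hamilton if it covers all vertices of $G$. For $1\le d<k$, $\delta_d(G)$ is the largest $m$ such that every $d$-set of vertices lies in at least $m$ edges. The threshold $\delta_d^{\mathrm{ham}}(k,\ell)$ is the infimum of all $\delta\in[0,1]$ such that for every $\varepsilon>0$ there is $n_0$ such that every $k$-graph $G$ on $n\ge n_0$ vertices with $n$ divisible by $k-\ell$ and $\delta_d(G)\ge(\delta+\varepsilon)\binom{n-d}{k-d}$ contains a Hamilton $\ell$-cycle. *)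

(* Defs.v *)
From HB Require Import structures.
From mathcomp Require Import all_boot all_order all_algebra.
From mathcomp Require Import classical_sets reals.
Set Implicit Arguments. Unset Strict Implicit. Unset Printing Implicit Defensive.
Import Order.TTheory GRing.Theory Num.Theory.

(* A k-graph on the vertex set 'I_n is given by its edge set
   E : {set {set 'I_n}}, all of whose edges have exactly k vertices. *)
Definition kuniform (k n : nat) (E : {set {set 'I_n}}) : Prop :=
  forall e, e \in E -> #|e| = k.

Definition codeg (n : nat) (E : {set {set 'I_n}}) (S : {set 'I_n}) : nat :=
  #|[set e in E | S \subset e]|.

Definition mindeg (n : nat) (E : {set {set 'I_n}}) (d : nat) : nat :=
  \big[minn/#|E|]_(S : {set 'I_n} | #|S| == d) codeg E S.

Definition cyc_edge (k l n : nat) (x0 : 'I_n) (vs : seq 'I_n) (i : nat)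
  : {set 'I_n} :=
  [set nth x0 vs ((i * (k - l) + j) %% n) | j : 'I_k].

Definition has_ham_cycle (k l n : nat) (E : {set {set 'I_n}}) : Prop :=
  exists (x0 : 'I_n) (vs : seq 'I_n),
    [/\ uniq vs, size vs = n &
      let m := n %/ (k - l) in
      forall i, i < m ->
        cyc_edge k l x0 vs i \in E /\
        #|cyc_edge k l x0 vs i :&: cyc_edge k l x0 vs ((i.+1) %% m)| = l].

Local Open Scope ring_scope.

Definition ham_sufficient (R : realType) (k l d : nat) (delta : R) : Prop :=
  forall eps : R, 0 < eps ->
  exists n0 : nat, forall n : nat, (n0 <= n)%N -> (k - l %| n)%N ->
    forall E : {set {set 'I_n}}, kuniform k E ->
      (delta + eps) * ('C(n - d, k - d))%:R <= (mindeg E d)%:R ->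
      has_ham_cycle k l E.

Definition ham_threshold (R : realType) (k l d : nat) : R :=
  inf [set delta : R | 0 <= delta <= 1 /\ ham_sufficient k l d delta].

(* Main.v *)
Require Import Defs.
From mathcomp Require Import classical_sets reals sequences exp.
From mathcomp Require Import all_boot all_order all_algebra all_fingroup.
From mathcomp Require Import ring lra zify.
Set Implicit Arguments. Unset Strict Implicit. Unset Printing Implicit Defensive.
Import Order.TTheory GRing.Theory Num.Theory.
Local Open Scope ring_scope.

(** Let G be a qk-graph on n = qm vertices with large minimum qd-degree. Split
    its vertices uniformly at random into m blocks of size q, and let H be the
    k-graph on the blocks whose edges are the k-sets of blocks with union in G.
    Fix d blocks and condition on their content S. The codegree of the d blocks
    in H has expected density at least that of the codegree of S in G, and a
    transposition of two vertices outside S changes it by a fraction O(1/m); a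
    bounded-differences inequality for random permutations shows that it drops
    below its mean by a constant fraction with probability exp(-Omega(m)). A
    union bound over the d-sets of blocks gives a partition for which H exceeds
    the threshold for (k, l, d), and a Hamilton l-cycle of H unfolds to a
    Hamilton ql-cycle of G. *)

(** * Concentration for random permutations *)

Section Concentration.
Variables (R : realType) (I : finType).
Implicit Types (S T : {set I}) (f g : {perm I} -> R).

(** Since [expR (- x)] is at least 1 - x, it suffices that (1 - x)(1 + x + 2x^2) = 1 + x^2 (1 - 2x)
    is at least 1. *)
Lemma expR_le_quadratic (x : R) : `|x| <= 2^-1 -> expR x <= 1 + x + 2 * x ^+ 2.
Proof.
rewrite ler_norml => /andP[xge xle].
have h1 : 1 - x <= expR (- x) by exact: expR_ge1Dx.
have x1 : 0 < 1 - x by lra.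
rewrite -(ler_pM2l (expR_gt0 (- x))) -expRD addNr expR0.
have h2 : 0 <= 1 + x + 2 * x ^+ 2 by nra.
apply: le_trans (ler_wpM2r h2 h1).
have -> : (1 - x) * (1 + x + 2 * x ^+ 2) = 1 + x ^+ 2 * (1 - 2 * x) by ring.
by rewrite lerDl mulr_ge0 ?sqr_ge0 //; lra.
Qed.

(** The mean also lies within c of [mu x0], so all deviations from it are at most 2c <= 1/2 and the
    quadratic bound applies to them. The linear terms cancel, and the quadratic ones give 2 (2c)^2 =
    8c^2. *)
Lemma mean_expR_le T (mu : I -> R) (x0 : I) (c : R) :
  x0 \in T -> c <= 4^-1 ->
  (forall y, y \in T -> `|mu y - mu x0| <= c) ->
  (\sum_(y in T) expR (mu y)) / #|T|%:R
    <= expR ((\sum_(y in T) mu y) / #|T|%:R + 8 * c ^+ 2).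
Proof.
move=> x0T c4 Hmu; set m := (X in _ <= expR (X + _)).
have N0 : 0 < #|T|%:R :> R by rewrite ltr0n; apply/card_gt0P; exists x0.
have sum_m : \sum_(y in T) mu y = #|T|%:R * m by rewrite /m mulrCA divff ?mulr1 // gt_eqF.
have near_m : `|m - mu x0| <= c.
  rewrite -(ler_pM2l N0) -{1}(gtr0_norm N0) -normrM mulrBr -sum_m.
  rewrite !mulr_natl -!sumr_const -sumrB.
  by apply: le_trans (ler_norm_sum _ _ _) _; exact: ler_sum.
have dev y : y \in T -> `|mu y - m| <= 2 * c.
  move=> yT; rewrite -(subrKA (mu x0)) (le_trans (ler_normD _ _)) //.
  by rewrite (distrC _ m) mulr_natl mulr2n lerD // Hmu.
rewrite ler_pdivrMr // expRD.
have -> : \sum_(y in T) expR (mu y) = expR m * \sum_(y in T) expR (mu y - m).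
  by rewrite mulr_sumr; apply: eq_bigr => y _; rewrite -expRD addrC subrK.
rewrite -mulrA ler_pM2l ?expR_gt0 //.
have step : \sum_(y in T) expR (mu y - m)
    <= \sum_(y in T) (1 + (mu y - m) + 8 * c ^+ 2).
  apply: ler_sum => y yT; have dy := dev y yT.
  apply: le_trans (expR_le_quadratic _) _; first by lra.
  rewrite lerD2l -(real_normK (num_real (mu y - m))).
  have := normr_ge0 (mu y - m); nra.
apply: le_trans step _.
rewrite !big_split /= sumrN sum_m !sumr_const -[m *+ _]mulr_natl subrr addr0.
rewrite -mulrnDl -[X in X <= _]mulr_natr ler_pM2r //; exact: expR_ge1Dx.
Qed.

(** As [perm_on T u] makes u fix all points outside [T], averaging [f (u * s)] is conditioning on
    the values of s outside [T]. *)
Definition perm_avg T f : R := (\sum_(u | perm_on T u) f u) / ((#|T|)`!)%:R.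

Lemma perm_avg_den T : 0 < ((#|T|)`!)%:R :> R.
Proof. by rewrite ltr0n fact_gt0. Qed.

Lemma sum_perm_on1 T : \sum_(u : {perm I} | perm_on T u) (1 : R) = ((#|T|)`!)%:R.
Proof. by rewrite sumr_const -card_perm. Qed.

Lemma perm_avg_cst T (a : R) : perm_avg T (fun=> a) = a.
Proof.
rewrite /perm_avg sumr_const -[a *+ _]mulr_natr card_perm.
by rewrite mulfK // gt_eqF // perm_avg_den.
Qed.

Lemma perm_avg_ler T f g :
  (forall u, perm_on T u -> f u <= g u) -> perm_avg T f <= perm_avg T g.
Proof.
by move=> fg; rewrite ler_pM2r ?invr_gt0 ?perm_avg_den //; exact: ler_sum.
Qed.

Lemma perm_avgZ T f (a : R) : perm_avg T (fun u => a * f u) = a * perm_avg T f.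
Proof. by rewrite /perm_avg -mulr_sumr mulrA. Qed.

Lemma perm_avgD T f g :
  perm_avg T (fun u => f u + g u) = perm_avg T f + perm_avg T g.
Proof. by rewrite /perm_avg big_split mulrDl. Qed.

Lemma perm_avg_sum T (J : finType) (P : pred J) (F : J -> {perm I} -> R) :
  perm_avg T (fun u => \sum_(j | P j) F j u) = \sum_(j | P j) perm_avg T (F j).
Proof. by rewrite /perm_avg exchange_big mulr_suml. Qed.

Lemma perm_avg_dist T f g (c : R) :
  (forall u, perm_on T u -> `|f u - g u| <= c) ->
  `|perm_avg T f - perm_avg T g| <= c.
Proof.
move=> fg; rewrite /perm_avg -mulrBl -sumrB normrM normfV.
rewrite (gtr0_norm (perm_avg_den T)) ler_pdivrMr ?perm_avg_den //.
rewrite -sum_perm_on1 mulr_sumr (le_trans (ler_norm_sum _ _ _)) //.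
by apply: ler_sum => u /fg; rewrite mulr1.
Qed.

Lemma perm_on_tperm T (i j : I) : i \in T -> j \in T -> perm_on T (tperm i j).
Proof.
move=> iT jT; rewrite /perm_on (subset_trans (tperm_on i j)) //.
by apply/subsetP=> z; rewrite !inE => /orP[]/eqP->.
Qed.

Lemma perm_on_subset S T (u : {perm I}) : S \subset T -> perm_on S u -> perm_on T u.
Proof. by move=> ST uS; exact: subset_trans uS ST. Qed.

(** Right multiplication by [tperm x y] matches the permutations fixing x with those sending x to y:
    the change of variables behind the recursive sampling below. *)
Lemma perm_on_D1_tperm T (x y : I) (v : {perm I}) : x \in T -> y \in T ->
  perm_on (T :\ x) v = perm_on T (v * tperm x y)%g && ((v * tperm x y)%g x == y).
Proof.
move=> xT yT; apply/idP/andP=> [von|[von /eqP]].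
  split; last by rewrite permM (out_perm von) ?tpermL // !inE eqxx.
  by rewrite perm_onM ?perm_on_tperm // (perm_on_subset _ von) // subD1set.
rewrite permM => vx; have {}vx : v x = x.
  by apply: (@perm_inj _ (tperm x y)); rewrite vx tpermL.
have {}von : perm_on T v by rewrite -(mulgK (tperm x y) v) tpermV perm_onM ?perm_on_tperm.
apply/subsetP=> z nfix; rewrite !inE (subsetP von) // andbT.
by apply: contra_neq _ nfix => ->.
Qed.

(* Sampling a random permutation by first choosing the image of x. *)
Lemma perm_avg_rec T f (x : I) : x \in T ->
  perm_avg T f =
  (\sum_(y in T) perm_avg (T :\ x) (fun v => f (v * tperm x y)%g)) / #|T|%:R.
Proof.
move=> xT; rewrite /perm_avg -mulr_suml (cardsD1 x T) xT add1n factS natrM.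
rewrite invfM mulrA mulrAC; congr (_ / _ / _).
rewrite (partition_big (fun u : {perm I} => u x) (mem T)) /=; last first.
  by move=> u uT; rewrite perm_closed.
apply: eq_bigr => y yT.
rewrite (reindex_onto (fun v => v * tperm x y)%g (fun u => u * tperm x y)%g) /=.
  apply: eq_bigl => v; rewrite -perm_on_D1_tperm //.
  by rewrite -mulgA -{2}(tpermV x y) mulgV mulg1 eqxx andbT.
by move=> u _; rewrite -mulgA -{2}(tpermV x y) mulgV mulg1.
Qed.

(* A bounded-differences inequality for random permutations: revealing one
   image at a time gives a martingale with increments at most 2c. *)
Lemma perm_avg_expR_le T f (c : R) : c <= 4^-1 ->
  (forall i j u, i \in T -> j \in T -> `|f (tperm i j * u)%g - f u| <= c) ->
  perm_avg T (fun u => expR (f u))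
    <= expR (perm_avg T f + 8 * c ^+ 2 * #|T|%:R).
Proof.
move=> c4; have [N] := ubnP #|T|; elim: N T f => // N IH T f ltN lip.
have [->|[x xT]] := set_0Vmem T.
  have one_u (g : {perm I} -> R) : perm_avg finset.set0 g = g 1%g.
    rewrite /perm_avg cards0 fact0 divr1 (big_pred1 1%g) // => u.
    apply/idP/eqP => [u0|->]; last exact: perm_on1.
    by apply/permP => z; rewrite perm1 (out_perm u0) // inE.
  by rewrite !one_u cards0 mulr0 addr0.
have cT : #|T| = #|T :\ x|.+1 by rewrite (cardsD1 x) xT.
have T0 : 0 < #|T|%:R :> R by rewrite cT.
rewrite (perm_avg_rec _ xT) (perm_avg_rec f xT).
set mu := fun y => perm_avg (T :\ x) (fun v => f (v * tperm x y)%g).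
have IHy y : y \in T -> perm_avg (T :\ x) (fun v => expR (f (v * tperm x y)%g))
    <= expR (mu y) * expR (8 * c ^+ 2 * #|T :\ x|%:R).
  move=> yT; rewrite -expRD.
  apply: (IH _ (fun v => f (v * tperm x y)%g)); first by rewrite -ltnS -cT.
  by move=> i j u /setD1P[_ iT] /setD1P[_ jT]; rewrite -mulgA; exact: lip.
apply: (@le_trans _ _ ((\sum_(y in T) expR (mu y)) / #|T|%:R
    * expR (8 * c ^+ 2 * #|T :\ x|%:R))).
  rewrite mulrAC ler_pM2r ?invr_gt0 // mulr_suml; exact: ler_sum.
apply: (@le_trans _ _ (expR ((\sum_(y in T) mu y) / #|T|%:R + 8 * c ^+ 2)
    * expR (8 * c ^+ 2 * #|T :\ x|%:R))).
  rewrite ler_pM2r ?expR_gt0 //; apply: (mean_expR_le xT c4) => y yT.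
  apply: perm_avg_dist => v von.
  have {}von : perm_on T v by rewrite (perm_on_subset _ von) // subD1set.
  rewrite tperm1 mulg1.
  (* Moving the transposition to the left of [v] conjugates it into another transposition of points
     of [T]. So [lip] bounds the gap between the conditional means [mu y] and [mu x]. *)
  have -> : (v * tperm x y = tperm (v^-1 x) (v^-1 y) * v)%g.
    by rewrite -tpermJ conjgE invgK -!mulgA mulVg mulg1.
  by apply: lip; rewrite perm_closed // perm_onV.
rewrite -expRD ler_expR -addrA lerD2l.
have -> : #|T|%:R = #|T :\ x|%:R + 1 :> R by rewrite cT natr1.
by rewrite mulrDr mulr1 addrC.
Qed.

(** Exponential Markov inequality: the indicator of X < a is at most expR (t (a - X)), and the
    moment bound applies to t (a - X), which a transposition changes by at most t c. *)
Lemma perm_avg_lower_tail T (X : {perm I} -> R) (c a b t : R) :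
  0 <= t -> t * c <= 4^-1 ->
  (forall i j u, i \in T -> j \in T -> `|X (tperm i j * u)%g - X u| <= c) ->
  b <= perm_avg T X ->
  perm_avg T (fun u => (X u < a)%R%:R)
    <= expR (t * (a - b) + 8 * (t * c) ^+ 2 * #|T|%:R).
Proof.
move=> t0 tc lip bX.
pose f u := t * a + - t * X u.
have favg : perm_avg T f = t * (a - perm_avg T X).
  by rewrite perm_avgD perm_avg_cst perm_avgZ mulrBr mulNr.
apply: (@le_trans _ _ (perm_avg T (fun u => expR (f u)))).
  apply: perm_avg_ler => u _; case: ltP => [ltXa|_]; last exact: expR_ge0.
  apply: le_trans (expR_ge1Dx _); rewrite lerDl /f; nra.
apply: le_trans (perm_avg_expR_le tc _) _ => [i j u iT jT|].
  rewrite /f opprD addrACA subrr add0r -mulrBr normrM normrN (ger0_norm t0).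
  by rewrite ler_wpM2l // lip.
by rewrite ler_expR favg lerD2r ler_wpM2l // lerD2l lerN2.
Qed.

End Concentration.

(** * Random images of a fixed set, and a union bound over permutations *)

Lemma card_supersets (I : finType) (D : {set I}) (k : nat) : (#|D| <= k)%N ->
  #|[set K : {set I} | D \subset K & #|K| == k]| = 'C(#|I| - #|D|, k - #|D|).
Proof.
move=> Dk; have -> : (#|I| - #|D| = #|~: D|)%N by rewrite [RHS]cardsCs setCK.
rewrite -cards_draws.
rewrite -[RHS](card_in_imset (f := fun A => D :|: A)) => [|A A'].
  apply: eq_card => K; rewrite !inE; apply/andP/imsetP => [[DK /eqP cK]|[A]].
    exists (K :\: D); last by rewrite setDE setUIr setUCr setIT (setUidPr DK).
    by rewrite inE setDE subsetIr -setDE cardsDS // cK eqxx.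
  rewrite inE => /andP[AD /eqP cA] ->; rewrite subsetUl cardsU cA.
  have -> : D :&: A = finset.set0 by apply/disjoint_setI0; rewrite disjoint_sym disjoints_subset.
  by rewrite cards0 subn0 subnKC.
rewrite !inE => /andP[AD _] /andP[AD' _] /(congr1 (fun X => X :&: ~: D)).
by rewrite !setIUl setICr !set0U (setIidPl AD) (setIidPl AD').
Qed.

Lemma imset_permM (I : finType) (u s : {perm I}) (W : {set I}) :
  (u * s)%g @: W = s @: (u @: W).
Proof. by rewrite -imset_comp; apply: eq_imset => x; rewrite permM. Qed.

Section RandomPermutations.
Variables (R : realType) (I : finType).

(* Any two supersets of B of the same size are related by transpositions of
   points outside B, and these act on the permutations being summed over. *)
Lemma sum_perm_on_superset (B W W' : {set I}) (P : pred {set I}) :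
  B \subset W -> B \subset W' -> #|W| = #|W'| ->
  \sum_(u : {perm I} | perm_on (~: B) u) (P (u @: W))%:R =
  \sum_(u : {perm I} | perm_on (~: B) u) (P (u @: W'))%:R :> R.
Proof.
move=> BW BW'; have [N] := ubnP #|W :\: W'|.
elim: N W BW => // N IH W BW ltN cWW'.
have [W0|[x]] := set_0Vmem (W :\: W').
  suff -> : W = W' by [].
  by apply/eqP; rewrite eqEcard cWW' leqnn andbT -setD_eq0 W0.
rewrite inE => /andP[xW' xW].
have [y] : exists y, y \in W' :\: W.
  apply/card_gt0P; rewrite cardsD setIC -cWW' -cardsD.
  by apply/card_gt0P; exists x; rewrite inE xW'.
rewrite inE => /andP[yW yW'].
have xB : x \in ~: B by rewrite inE; apply: contra xW' => /(subsetP BW').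
have yB : y \in ~: B by rewrite inE; apply: contra yW => /(subsetP BW).
have ton := perm_on_tperm xB yB.
have memt z : (z \in tperm x y @: W) = (tperm x y z \in W).
  by rewrite -{1}(tpermK x y z) mem_imset //; exact: perm_inj.
rewrite -(IH (tperm x y @: W)); first last.
- by rewrite card_imset //; exact: perm_inj.
- rewrite -ltnS (leq_trans _ ltN) // ltnS proper_card //; apply/properP; split.
    apply/subsetP=> z; rewrite !inE memt => /andP[zW'].
    case: tpermP => [_|zy|_ _]; first by rewrite (negPf yW).
      by rewrite zy yW' in zW'.
    by rewrite zW'.
  by exists x; rewrite !inE ?xW' // memt tpermL (negPf yW).
- apply/subsetP=> z zB; rewrite memt (out_perm ton) ?inE ?negbK //.
  exact: (subsetP BW).
rewrite (reindex_inj (mulgI (tperm x y))); apply: eq_big => u.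
  apply/idP/idP => uon; last exact: perm_onM.
  by rewrite -(mulKg (tperm x y) u) tpermV perm_onM.
by rewrite imset_permM.
Qed.

(** For random u fixing B pointwise, [u @: W] is uniform among the supersets of B of size [#|W|]:
    the average is the same for all such supersets, and each u permutes them. *)
Lemma perm_avg_superset (B W : {set I}) (P : pred {set I}) : B \subset W ->
  perm_avg (R := R) (~: B) (fun u => (P (u @: W))%:R) * ('C(#|I| - #|B|, #|W| - #|B|))%:R
  = #|[set W' : {set I} | (B \subset W') && (#|W'| == #|W|) & P W']|%:R.
Proof.
move=> BW; rewrite -card_supersets ?subset_leq_card //.
rewrite /perm_avg mulrAC; set F := [set K : {set I} | _ & _].
suff -> : (\sum_(u | perm_on (~: B) u) (P (u @: W))%:R) * #|F|%:R =
   \sum_(u : {perm I} | perm_on (~: B) u)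
      #|[set W' : {set I} | (B \subset W') && (#|W'| == #|W|) & P W']|%:R :> R.
  rewrite sumr_const -[_ *+ _]mulr_natr card_perm mulfK //.
  by rewrite gt_eqF // perm_avg_den.
rewrite mulr_natr -sumr_const.
transitivity (\sum_(W' in F) \sum_(u : {perm I} | perm_on (~: B) u) (P (u @: W'))%:R : R).
  apply: eq_bigr => W'; rewrite inE => /andP[BW' /eqP cW'].
  exact: sum_perm_on_superset.
rewrite exchange_big; apply: eq_bigr => u uon.
rewrite -sum1_card natr_sum [RHS](reindex_inj (imset_inj (@perm_inj _ u))) /=.
rewrite (big_mkcond (mem F)) [RHS]big_mkcond; apply: eq_bigr => W' _.
rewrite !inE card_imset; last exact: perm_inj.
have -> : (B \subset u @: W') = (B \subset W').
  have ux x : x \in B -> (x \in u @: W') = (x \in W').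
    move=> xB; rewrite -{1}(out_perm uon (x := x)) ?inE ?negbK //.
    by rewrite mem_imset //; exact: perm_inj.
  by apply/subsetP/subsetP => h x xB; have := h x xB; rewrite ux.
by case: ifP => // _; case: (P _).
Qed.

(** Law of total expectation: for each u, the map sending s to [u * s] is a bijection. *)
Lemma sum_perm_avg (T : {set I}) (g : {perm I} -> R) :
  \sum_s perm_avg T (fun u => g (u * s)%g) = \sum_s g s.
Proof.
rewrite -mulr_suml exchange_big /=.
rewrite (eq_bigr (fun=> \sum_s g s)); last first.
  by move=> u _; rewrite [RHS](reindex_inj (mulgI u)).
rewrite sumr_const -[_ *+ _]mulr_natr card_perm mulfK //.
by rewrite gt_eqF // perm_avg_den.
Qed.

(** Each bad event may be bounded under its own conditioning [T j]; total expectation turns this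
    into an unconditional bound. If every s were bad for some j, the bad pairs would number at least
    all permutations. *)
Lemma perm_union_bound (J : finType) (P : pred J) (T : J -> {set I})
    (bad : J -> pred {perm I}) (rho : R) :
  (forall j s, P j -> perm_avg (R := R) (T j) (fun u => (bad j (u * s)%g)%:R) <= rho) ->
  #|P|%:R * rho < 1 ->
  exists s, forall j, P j -> ~~ bad j s.
Proof.
move=> Hbad Hrho.
case: (pickP [pred s : {perm I} | [forall j, P j ==> ~~ bad j s]]) => [s|none].
  by move=> /forallP/= good; exists s => j; apply/implyP.
have card0 : 0 < #|{perm I}|%:R :> R by rewrite ltr0n; apply/card_gt0P; exists 1%g.
have : #|{perm I}|%:R <= \sum_(s : {perm I}) \sum_(j | P j) (bad j s)%:R :> R.
  rewrite -sum1_card natr_sum; apply: ler_sum => s _.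
  have /negbT := none s; rewrite negb_forall => /existsP[j].
  rewrite negb_imply negbK => /andP[Pj badj].
  by rewrite (bigD1 j) //= badj lerDl sumr_ge0.
rewrite exchange_big /= leNgt => /negP[].
have le_j j : P j -> \sum_(s : {perm I}) (bad j s)%:R <= #|{perm I}|%:R * rho.
  move=> Pj; rewrite -(sum_perm_avg (T j)) mulr_natl -sumr_const.
  by apply: ler_sum => s _; exact: Hbad.
apply: le_lt_trans (ler_sum _ le_j) _.
by rewrite sumr_const -[_ *+ _]mulr_natl mulrCA gtr_pMr.
Qed.

End RandomPermutations.

(** * Blocks, the block graph, and unfolding a Hamilton cycle *)

Section Blocks.
Variables (q m : nat).

Lemma block_index_subproof (p : 'I_(q * m)) : (p %/ q < m)%N.
Proof. by case: q p => [|q'] [p ltp] //=; rewrite ltn_divLR // mulnC. Qed.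

Definition block_index (p : 'I_(q * m)) : 'I_m := Ordinal (block_index_subproof p).

Lemma block_elt_subproof (i : 'I_m) (r : 'I_q) : (q * i + r < q * m)%N.
Proof.
by rewrite (@leq_trans (q * i.+1)%N) // ?leq_mul2l ?ltn_ord ?orbT // mulnS addnC ltn_add2r.
Qed.

Definition block_elt (i : 'I_m) (r : 'I_q) : 'I_(q * m) :=
  Ordinal (block_elt_subproof i r).

Definition blocks (K : {set 'I_m}) : {set 'I_(q * m)} := block_index @^-1: K.

Lemma block_eltK (i : 'I_m) (r : 'I_q) : block_index (block_elt i r) = i.
Proof.
apply: val_inj => /=; have q0 := leq_ltn_trans (leq0n r) (ltn_ord r).
by rewrite mulnC divnMDl // divn_small // addn0.
Qed.

Lemma block_elt_inj (i i' : 'I_m) (r r' : 'I_q) :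
  block_elt i r = block_elt i' r' -> i = i' /\ r = r'.
Proof.
move=> e; have ei : i = i' by rewrite -(block_eltK i r) e block_eltK.
split=> //; apply: val_inj; move/(congr1 val): e => /= /eqP.
by rewrite ei eqn_add2l => /eqP.
Qed.

Lemma block_eltE (q0 : (0 < q)%N) (p : 'I_(q * m)) :
  p = block_elt (block_index p) (Ordinal (ltn_pmod p q0)).
Proof. by apply: val_inj => /=; rewrite [(q * (p %/ q))%N]mulnC -divn_eq. Qed.

Lemma card_blocks (K : {set 'I_m}) : #|blocks K| = (q * #|K|)%N.
Proof.
have [q0|q0] := posnP q.
  rewrite [RHS](_ : _ = 0%N) ?q0 //; apply: eq_card0 => -[p ltp].
  by exfalso; move: ltp; rewrite q0.
have <- : #|setX K [set: 'I_q]| = (q * #|K|)%N by rewrite cardsX cardsT card_ord mulnC.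
rewrite -(card_imset (f := fun ir => block_elt ir.1 ir.2)); last first.
  by move=> [i r] [i' r'] /block_elt_inj /= [-> ->].
apply: eq_card => p; rewrite inE; apply/idP/imsetP => [pK|[[i r]]].
  exists (block_index p, Ordinal (ltn_pmod p q0)); last exact: block_eltE.
  by rewrite !inE pK.
by rewrite !inE /= andbT => iK ->; rewrite block_eltK.
Qed.

Lemma blocksS (K K' : {set 'I_m}) : K \subset K' -> blocks K \subset blocks K'.
Proof. exact: preimsetS. Qed.

(** The partition is encoded by a permutation: the blocks are fixed intervals of q positions, and
    [s] places the vertices in them, so the blocks in K have content [s @: blocks K]. *)
Definition block_graph (k : nat) (E : {set {set 'I_(q * m)}}) (s : 'S_(q * m)) :
  {set {set 'I_m}} := [set K : {set 'I_m} | (#|K| == k) && (s @: blocks K \in E)].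

Lemma block_graph_uniform k E s : kuniform k (block_graph k E s).
Proof. by move=> e; rewrite inE => /andP[/eqP]. Qed.

Lemma codeg_block_graph k E s (D : {set 'I_m}) :
  codeg (block_graph k E s) D =
  (\sum_(K in [set K : {set 'I_m} | D \subset K & #|K| == k])
    (s @: blocks K \in E))%N.
Proof.
rewrite /codeg -sum1_card [RHS]big_mkcond [LHS]big_mkcond; apply: eq_bigr => K _.
by rewrite !inE andbAC andbC; case: (D \subset K); case: (#|K| == k) => //=; case: (_ \in E).
Qed.

Section HamiltonCycle.
Variables (k l : nat) (E : {set {set 'I_(q * m)}}) (s : 'S_(q * m)).
Variables (q0 : (0 < q)%N) (x0 : 'I_m) (vs : seq 'I_m).

(** The unfolded cyclic order lists the blocks in the order [vs], each replaced by its q vertices in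
    a row. *)
Definition blowup_vertex (p : nat) : 'I_(q * m) :=
  s (block_elt (nth x0 vs (p %/ q)) (Ordinal (ltn_pmod p q0))).

Definition blowup : seq 'I_(q * m) := mkseq blowup_vertex (q * m).

Lemma blowup_uniq : uniq vs -> size vs = m -> uniq blowup.
Proof.
move=> uvs svs; apply/mkseq_uniqP => p p'; rewrite !inE => ltp ltp'.
move/perm_inj/block_elt_inj => [e /(congr1 val) /= er].
rewrite (divn_eq p q) (divn_eq p' q) er; congr (_ * _ + _)%N.
by apply/eqP; rewrite -(nth_uniq x0 _ _ uvs) ?svs ?ltn_divLR // 1?mulnC // e.
Qed.

(** The window starts at i (qk - ql), a multiple of q, and has length qk, so it consists of k whole
    blocks; wrapping around modulo qm becomes wrapping around modulo m on blocks. *)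
Lemma cyc_edge_blowup (y0 : 'I_(q * m)) (i : nat) :
  cyc_edge (q * k) (q * l) y0 blowup i = s @: blocks (cyc_edge k l x0 vs i).
Proof.
have m0 : (0 < m)%N := leq_ltn_trans (leq0n x0) (ltn_ord x0).
have idx j : nth y0 blowup ((i * (q * k - q * l) + j) %% (q * m)) =
  s (block_elt (nth x0 vs ((i * (k - l) + j %/ q) %% m)) (Ordinal (ltn_pmod j q0))).
  rewrite nth_mkseq ?ltn_pmod ?muln_gt0 ?q0 // /blowup_vertex.
  have -> : ((i * (q * k - q * l) + j) %% (q * m) %/ q =
            (i * (k - l) + j %/ q) %% m)%N.
    rewrite [(q * m)%N]mulnC -modn_divl -mulnBr mulnCA mulnC divnMDl //.
  congr (s (block_elt _ _)); apply: val_inj => /=.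
  by rewrite modn_dvdm ?dvdn_mulr // -mulnBr mulnCA mulnC modnMDl.
apply/setP => v; apply/imsetP/imsetP => [[j _ ->]|[p]].
  rewrite idx; eexists; last by [].
  rewrite inE block_eltK; apply/imsetP.
  have ltj : (j %/ q < k)%N by rewrite ltn_divLR // [(k * q)%N]mulnC ltn_ord.
  by exists (Ordinal ltj).
rewrite inE => /imsetP[a _ pa] ->.
have ltj : (q * a + p %% q < q * k)%N.
  by rewrite (@leq_trans (q * a.+1)%N) ?leq_mul2l ?ltn_ord ?orbT // mulnS addnC ltn_add2r ltn_pmod.
exists (Ordinal ltj) => //; rewrite idx /= [LHS](congr1 s (block_eltE q0 p)) pa.
congr (s (block_elt _ _)).
  by rewrite [(q * a)%N]mulnC divnMDl // (divn_small (ltn_pmod p q0)) addn0.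
by apply: val_inj; rewrite /= [(q * a)%N]mulnC modnMDl modn_mod.
Qed.

End HamiltonCycle.

Lemma ham_cycle_blowup k l (E : {set {set 'I_(q * m)}}) (s : 'S_(q * m)) :
  (0 < q)%N -> has_ham_cycle k l (block_graph k E s) ->
  has_ham_cycle (q * k) (q * l) E.
Proof.
move=> q0 [x0 [vs [uvs svs /= edges]]].
exists (block_elt x0 (Ordinal q0)), (blowup s q0 x0 vs); split.
- exact: blowup_uniq.
- by rewrite size_mkseq.
rewrite -mulnBr divnMl //= => i lti; have [inH cI] := edges i lti.
rewrite !cyc_edge_blowup; split; first by move: inH; rewrite inE => /andP[].
rewrite -imsetI; last by move=> x y _ _; exact: perm_inj.
by rewrite -preimsetI card_imset ?card_blocks ?cI //; exact: perm_inj.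
Qed.

End Blocks.

(** * Mean and lower tail of the codegrees in the block graph *)

Section BlockGraphDegrees.
Variables (R : realType) (q m k : nat).
Variables (E : {set {set 'I_(q * m)}}) (D : {set 'I_m}).
Hypothesis ltDk : (#|D| < k)%N.

(** Swapping i and j can only affect those K that contain the block of i or of j. Neither block is
    in D, so each lies in as many K as there are k-sets containing one block more than D. *)
Lemma codeg_block_graph_lipschitz (i j : 'I_(q * m)) (s : 'S_(q * m)) :
  i \in ~: blocks q D -> j \in ~: blocks q D ->
  `|(codeg (block_graph k E (tperm i j * s)%g) D)%:R
    - (codeg (block_graph k E s) D)%:R|
  <= 2 * ('C(m - #|D|.+1, k - #|D|.+1))%:R :> R.
Proof.
rewrite !inE => iD jD; rewrite !codeg_block_graph !natr_sum -sumrB.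
set F := [set K : {set 'I_m} | _ & _].
have count (b : 'I_m) : b \notin D ->
    \sum_(K in F) (b \in K)%:R = ('C(m - #|D|.+1, k - #|D|.+1))%:R :> R.
  move=> bD; have cbD : #|b |: D| = #|D|.+1 by rewrite cardsU1 bD.
  rewrite -cbD -[X in 'C(X - _, _)](card_ord m) -card_supersets ?cbD //.
  rewrite -sum1_card natr_sum big_mkcond [RHS]big_mkcond; apply: eq_bigr => K _.
  by rewrite !inE subUset sub1set; case: (b \in K); case: ifP.
apply: (@le_trans _ _ (\sum_(K in F)
    ((block_index i \in K)%:R + (block_index j \in K)%:R))); last first.
  by rewrite big_split /= !count // mulr_natl mulr2n.
apply: le_trans (ler_norm_sum _ _ _) _; apply: ler_sum => K _.
have [iK|iK] := boolP (block_index i \in K).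
  rewrite (le_trans (_ : _ <= 1)) ?lerDl //.
  by do 2!case: (_ \in E); rewrite /= ?subrr ?subr0 ?sub0r ?normrN ?normr0 ?normr1.
have [jK|jK] := boolP (block_index j \in K).
  by rewrite add0r; do 2!case: (_ \in E); rewrite /= ?subrr ?subr0 ?sub0r ?normrN ?normr0 ?normr1.
rewrite imset_permM; have -> : tperm i j @: blocks q K = blocks q K.
  rewrite -[RHS]imset_id; apply: eq_in_imset => z; rewrite inE => zK.
  by rewrite tpermD //; [apply: contraNneq iK|apply: contraNneq jK] => ->.
by rewrite subrr normr0 addr0.
Qed.

(** Linearity of expectation: given the content of D, the content of each k-set K containing D is a
    uniform qk-set containing it. The identity is cross-multiplied to avoid division. *)
Lemma perm_avg_codeg (s : 'S_(q * m)) : kuniform (q * k) E ->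
  perm_avg (~: blocks q D) (fun u => (codeg (block_graph k E (u * s)%g) D)%:R)
    * ('C(q * m - q * #|D|, q * k - q * #|D|))%:R
  = ('C(m - #|D|, k - #|D|))%:R * (codeg E (s @: blocks q D))%:R :> R.
Proof.
move=> uE; set F := [set K : {set 'I_m} | D \subset K & #|K| == k].
have -> : perm_avg (~: blocks q D)
    (fun u => (codeg (block_graph k E (u * s)%g) D)%:R) =
  \sum_(K in F) perm_avg (~: blocks q D) (fun u => (s @: (u @: blocks q K) \in E)%:R) :> R.
  rewrite -perm_avg_sum /perm_avg; congr (_ / _); apply: eq_bigr => u _.
  rewrite codeg_block_graph natr_sum; apply: eq_bigr => K _.
  by rewrite imset_permM.
rewrite -[X in 'C(X - _, _ - _)%:R * _](card_ord m) -card_supersets ?(ltnW ltDk) //.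
rewrite mulr_suml mulr_natl -sumr_const; apply: eq_bigr => K.
rewrite inE => /andP[DK /eqP cK].
have := perm_avg_superset R (fun W => s @: W \in E) (blocksS q DK).
rewrite !card_blocks cK card_ord => ->; congr _%:R.
rewrite -(card_imset _ (imset_inj (@perm_inj _ s))); apply: eq_card => e.
rewrite inE; apply/imsetP/andP => [[W]|[eE sDe]].
  rewrite !inE => /andP[/andP[DW _] WE] ->; split=> //; exact: imsetS.
have se : e = s @: (s^-1%g @: e).
  rewrite -imset_comp -[LHS]imset_id; apply: eq_imset => x /=.
  by rewrite permKV.
exists (s^-1%g @: e) => //; rewrite !inE -se eE andbT card_imset; last exact: perm_inj.
rewrite uE // eqxx andbT; apply/subsetP => x xD.
rewrite -(permK s x) mem_imset; last exact: perm_inj.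
by rewrite (subsetP sDe) // imset_f.
Qed.

(** The first condition on [a] keeps t c = 2aK at most 1/4. The second makes the quadratic error at
    most a eps N / 4, half of the linear gain a eps N / 2. *)
Lemma block_graph_lower_tail (s : 'S_(q * m)) (delta eps a : R) :
  kuniform (q * k) E -> (k <= m)%N -> 0 <= a ->
  8 * a * (k - #|D|)%:R <= 1 ->
  128 * a * (k - #|D|)%:R ^+ 2 * q%:R <= eps ->
  (delta + eps) * ('C(q * m - q * #|D|, q * k - q * #|D|))%:R
    <= (codeg E (s @: blocks q D))%:R ->
  perm_avg (~: blocks q D) (fun u =>
    ((codeg (block_graph k E (u * s)%g) D)%:R
       < (delta + eps / 2) * ('C(m - #|D|, k - #|D|))%:R)%R%:R)
  <= expR (- (a * eps / 4 * (m - #|D|)%:R)).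
Proof.
move=> uE km a0 aK aE degE.
set N := (m - #|D|)%N; set K := (k - #|D|)%N in aK aE *.
set C := ('C(N, K))%:R.
have C0 : 0 < C :> R by rewrite ltr0n bin_gt0 leq_sub2r.
have N0 : 0 < N%:R :> R by rewrite ltr0n subn_gt0 (leq_trans ltDk).
have Ceq : N%:R * ('C(m - #|D|.+1, k - #|D|.+1))%:R = K%:R * C :> R.
  have -> : (m - #|D|.+1 = N.-1)%N by rewrite subnS.
  have -> : (k - #|D|.+1 = K.-1)%N by rewrite subnS.
  have K0 : (0 < K)%N by rewrite subn_gt0.
  by rewrite -natrM mul_bin_diag prednK // natrM.
(* By [Ceq] the Lipschitz constant is 2KC/N; this scaling makes t c independent of m. *)
pose t := a * N%:R / C.
have tc : t * (2 * ('C(m - #|D|.+1, k - #|D|.+1))%:R) = 2 * a * K%:R.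
  rewrite /t; apply: (mulIf (lt0r_neq0 C0)).
  rewrite -[RHS]mulrA -Ceq; field; exact: lt0r_neq0.
have cT : #|~: blocks q D|%:R = q%:R * N%:R :> R.
  by rewrite cardsCs setCK card_ord card_blocks -mulnBr natrM.
have avg : (delta + eps) * C <= perm_avg (~: blocks q D)
    (fun u => (codeg (block_graph k E (u * s)%g) D)%:R).
  have B0 : 0 < ('C(q * m - q * #|D|, q * k - q * #|D|))%:R :> R.
    by rewrite ltr0n bin_gt0 leq_sub2r // leq_mul2l km orbT.
  rewrite -(ler_pM2r B0) perm_avg_codeg // mulrAC [X in _ <= X]mulrC.
  by rewrite ler_wpM2r // ltW.
have := @perm_avg_lower_tail R _ (~: blocks q D)
  (fun u => (codeg (block_graph k E (u * s)%g) D)%:R)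
  (2 * ('C(m - #|D|.+1, k - #|D|.+1))%:R) ((delta + eps / 2) * C) _ t _ _ _ avg.
rewrite tc cT => tail; apply: le_trans (tail _ _ _) _.
- by rewrite /t divr_ge0 ?mulr_ge0 // ltW.
- lra.
- by move=> i j u iD jD; rewrite -mulgA; exact: codeg_block_graph_lipschitz.
rewrite ler_expR.
have -> : t * ((delta + eps / 2) * C - (delta + eps) * C) = - (a * eps / 2 * N%:R).
  by rewrite /t; field; exact: lt0r_neq0.
have -> : 8 * (2 * a * K%:R) ^+ 2 * (q%:R * N%:R) =
   (128 * a * K%:R ^+ 2 * q%:R) * (a / 4 * N%:R) by field.
have aN : 0 <= a / 4 * N%:R by rewrite mulr_ge0 ?divr_ge0 // ltW.
have := ler_wpM2r aN aE; lra.
Qed.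

End BlockGraphDegrees.

(** * Growth estimates, minimum degrees and comparison of thresholds *)

Lemma bin_le_exp (n d : nat) : ('C(n, d) <= n ^ d)%N.
Proof.
apply: (@leq_trans (n ^_ d)); first by rewrite -bin_ffact leq_pmulr ?fact_gt0.
elim: d => [|d IH]; first by rewrite ffactn0.
by rewrite ffactnSr expnSr leq_mul // leq_subr.
Qed.

Lemma bin_expR_small (R : realType) (d : nat) (b : R) : 0 < b ->
  exists N : nat, forall M : nat, (N <= M)%N ->
    ('C(M + d, d))%:R * expR (- (b * M%:R)) < 1.
Proof.
(* From M >= x on, (2M)^d is at most (bM)^(d+1) / (d+1)!, a term of the exponential series; M >= d
   gives M + d <= 2M. *)
move=> b0; set x := 2 ^+ d * ((d.+1)`!)%:R / b ^+ d.+1.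
have f0 : 0 < ((d.+1)`!)%:R :> R by rewrite ltr0n fact_gt0.
have x0 : 0 <= x by rewrite divr_ge0 ?mulr_ge0 ?exprn_ge0 // ltW.
exists (maxn d (Num.bound x)) => M; rewrite geq_max => /andP[dM xM].
have xM' : x <= M%:R.
  by apply: ltW; apply: lt_le_trans (archi_boundP x0) _; rewrite ler_nat.
rewrite expRN ltr_pdivrMr ?expR_gt0 // mul1r.
apply: lt_le_trans (expR_ge1Dxn d _); last by rewrite mulr_ge0 // ltW.
apply: (@le_lt_trans _ _ ((2 * M%:R) ^+ d)).
  apply: (@le_trans _ _ ((M + d)%:R ^+ d)).
    by rewrite -natrX ler_nat bin_le_exp.
  by rewrite lerXn2r ?nnegrE ?mulr_ge0 // -natrM ler_nat; lia.
apply: (@le_lt_trans _ _ ((b * M%:R) ^+ d.+1 / ((d.+1)`!)%:R)); last by rewrite ltrDr.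
rewrite ler_pdivlMr // !exprMn [M%:R ^+ d.+1]exprS [leRHS]mulrA [leLHS]mulrAC.
rewrite ler_wpM2r ?exprn_ge0 //.
by move: xM'; rewrite /x ler_pdivrMr ?exprn_gt0 // [M%:R * _]mulrC.
Qed.

Lemma leq_mindeg (n : nat) (E : {set {set 'I_n}}) (d : nat) (S : {set 'I_n}) :
  #|S| = d -> (mindeg E d <= codeg E S)%N.
Proof.
move=> /eqP cS; rewrite /mindeg.
elim: (index_enum _) (mem_index_enum S) => // S' r IH; rewrite inE big_cons.
case/predU1P => [<-|/IH le_r]; first by rewrite cS geq_minl.
by case: ifP => // _; rewrite geq_min le_r orbT.
Qed.

Lemma mindeg_ge (R : realType) (n : nat) (E : {set {set 'I_n}}) (d : nat) (b : R) :
  (d <= n)%N ->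
  (forall S : {set 'I_n}, #|S| = d -> b <= (codeg E S)%:R) -> b <= (mindeg E d)%:R.
Proof.
move=> dn Hb; apply: (big_ind (fun x : nat => b <= x%:R)).
(* The default [#|E|] of the iterated minimum must also be at least b: it dominates the codegree of
   some d-set, which exists because d <= n. *)
- have : (0 < 'C(n, d))%N by rewrite bin_gt0.
  rewrite -{1}(card_ord n) -cardsT -cards_draws => /card_gt0P[S].
  rewrite inE => /andP[_ /eqP /Hb h]; apply: le_trans h _; rewrite ler_nat.
  by apply: subset_leq_card; apply/subsetP => e; rewrite inE => /andP[].
- by move=> x y bx bY; case: (leqP x y) => // /ltnW.
- by move=> S /eqP; exact: Hb.
Qed.

Lemma codeg_le_bin (n k : nat) (E : {set {set 'I_n}}) (S : {set 'I_n}) :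
  kuniform k E -> (#|S| <= k)%N -> (codeg E S <= 'C(n - #|S|, k - #|S|))%N.
Proof.
move=> uE Sk; rewrite -[X in 'C(X - _, _)](card_ord n) -card_supersets //.
apply: subset_leq_card; apply/subsetP => e.
by rewrite !inE => /andP[/uE -> ->]; rewrite eqxx.
Qed.

Lemma ham_sufficient_blowup (R : realType) (k d l q : nat) (delta : R) :
  (d < k)%N -> (l < k)%N -> (0 < q)%N ->
  ham_sufficient k l d delta ->
  ham_sufficient (q * k) (q * l) (q * d) delta.
Proof.
move=> dk lk q0 suff eps eps0.
(* Half of [eps] is given up in passing to the block graph; the other half is the slack required by
   [suff]. *)
have [n1 Hn1] := suff _ (divr_gt0 eps0 (ltr0Sn R 1)).
set K := (k - d)%N.
have K0 : 0 < K%:R :> R by rewrite ltr0n subn_gt0.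
have Q0 : 0 < q%:R :> R by rewrite ltr0n.
(* Each summand of [den] secures one of the two conditions on [a] in the tail bound. *)
set den := 128 * K%:R ^+ 2 * q%:R + 8 * K%:R * eps.
have den0 : 0 < den by rewrite addr_gt0 // !mulr_gt0 // ?exprn_gt0.
pose a := eps / den.
have a0 : 0 < a by rewrite divr_gt0.
have aden : a * den = eps by rewrite /a divfK // gt_eqF.
clearbody a.
have aK : 8 * a * K%:R <= 1.
  rewrite -(ler_pM2r eps0) mul1r -[leRHS]aden /den -subr_ge0.
  rewrite (_ : _ - _ = a * (128 * K%:R ^+ 2 * q%:R)); last by ring.
  by rewrite ltW // !mulr_gt0 ?exprn_gt0.
have aE : 128 * a * K%:R ^+ 2 * q%:R <= eps.
  rewrite -[leRHS]aden /den -subr_ge0.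
  rewrite (_ : _ - _ = a * (8 * K%:R * eps)); last by ring.
  by rewrite ltW // !mulr_gt0.
have b0 : 0 < a * eps / 4 by rewrite divr_gt0 ?mulr_gt0.
have [n2 Hn2] := bin_expR_small d b0.
(* With n = qm this gives m >= n1 for [suff], m - d >= n2 for the union bound, and m >= k. *)
exists (q * (n1 + n2 + k + d))%N => n len.
rewrite -mulnBr => /dvdnP[c nE] E uE degE.
have {nE} nE : n = (q * (c * (k - l)))%N by rewrite nE mulnCA.
move: E uE degE len; rewrite {n}nE.
set m := (c * (k - l))%N => E uE degE; rewrite leq_pmul2l // => len.
have km : (k <= m)%N by lia.
have dm : (d <= m)%N by lia.
pose bad (D : {set 'I_m}) (s : 'S_(q * m)) :=
  (codeg (block_graph k E s) D)%:R < (delta + eps / 2) * ('C(m - d, k - d))%:R.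
have [s good] : exists s, forall D : {set 'I_m}, #|D| == d -> ~~ bad D s.
  apply: (@perm_union_bound R _ _ _ (fun D => ~: blocks q D) _
    (expR (- (a * eps / 4 * (m - d)%:R)))) => [D s /eqP cD|].
    rewrite /bad -cD; apply: block_graph_lower_tail => //; rewrite ?cD //.
      exact: ltW.
    apply: le_trans degE _; rewrite ler_nat leq_mindeg //.
    by rewrite card_imset ?card_blocks ?cD //; exact: perm_inj.
  have -> : #|[pred D : {set 'I_m} | #|D| == d]| = 'C(m - d + d, d).
    rewrite subnK // -[X in 'C(X, _)](card_ord m) -cardsT -cards_draws.
    by apply: eq_card => D; rewrite !inE subsetT.
  by apply: Hn2; lia.
apply: (@ham_cycle_blowup q m k l E s) => //.
apply: Hn1; first by lia.
- exact: dvdn_mull.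
- exact: block_graph_uniform.
apply: mindeg_ge => // D /eqP cD; rewrite leNgt; exact: good.
Qed.

(** No codegree exceeds the full binomial, so the degree condition is never met for n >= k. This
    makes the set defining the threshold nonempty. *)
Lemma ham_sufficient1 (R : realType) (k l d : nat) : (d < k)%N ->
  ham_sufficient k l d (1 : R).
Proof.
move=> dk eps eps0; exists k => n kn _ E uE degE; exfalso.
have : (0 < 'C(n, d))%N by rewrite bin_gt0 (leq_trans (ltnW dk)).
rewrite -{1}(card_ord n) -cardsT -cards_draws => /card_gt0P[S].
rewrite inE => /andP[_ /eqP cS].
have C0 : 0 < ('C(n - d, k - d))%:R :> R by rewrite ltr0n bin_gt0 leq_sub2r.
have : (mindeg E d)%:R <= ('C(n - d, k - d))%:R :> R.
  rewrite ler_nat (leq_trans (leq_mindeg E cS)) // -cS codeg_le_bin // cS.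
  exact: ltnW.
by nra.
Qed.

Theorem theorem1p6 (R : realType) (k d l q : nat) :
  (1 <= d <= k - 1)%N -> (1 <= l <= k - 1)%N -> (2 <= q)%N ->
  ham_threshold R (q * k) (q * l) (q * d) <= ham_threshold R k l d.
Proof.
move=> hd hl hq; have dk : (d < k)%N by lia.
have lk : (l < k)%N by lia.
(* Each density admissible for (k, l, d) is admissible for (qk, ql, qd), so the infima compare: the
   first set contains 1 and the second is bounded below by 0. *)
apply: lb_le_inf.
  by exists 1; rewrite /= ler01 lexx; split=> //; exact: ham_sufficient1.
move=> delta [d01 suff]; apply: ge_inf.
  by exists 0 => x [/andP[]].
by split=> //; apply: ham_sufficient_blowup => //; lia.
Qed.
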